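(* Let $m\in C(\mathbb T)$ and let $\omega(m,\delta)=\sup_{|t_1-t_2|\le\delta}|m(t_1)-m(t_2)|$ be its modulus of continuity. If $$\int_0^\pi\frac{\omega(m,\delta)}{\delta}\,d\delta<\infty,$$ then $m\in MU(\mathbb T)$, and $$\|m\|_{MU(\mathbb T)}\le\|m\|_{C(\mathbb T)}+2\int_0^\pi\frac{\omega(m,\delta)}{\delta}\,d\delta.$$
   Context: $\mathbb T=\mathbb R/(2\pi\mathbb Z)$; functions on $\mathbb T$ (complex-valued) are identified with $2\pi$-periodic functions on $\mathbb R$. $C(\mathbb T)$ is the space of continuous functions on $\mathbb T$ with $\|f\|_{C(\mathbb T)}=\sup_{t}|f(t)|$. Fourier coefficients: $\widehat f(k)=\frac1{2\pi}\int_{\mathbb T}f(t)e^{-ikt}dt$, and $S_N(f)(t)=\sum_{|k|\le N}\widehat f(k)e^{ikt}$, $N=0,1,2,\dots$. $U(\mathbb T)$ is the Banach space of all $f\in C(\mathbb T)$ such that $\|f-S_N(f)\|_{C(\mathbb T)}\to0$ as $N\to\infty$, with norm $\|f\|_{U(\mathbb T)}=\sup_N\|S_N(f)\|_{C(\mathbb T)}$. $MU(\mathbb T)$ is the space of pointwise multipliers of $U(\mathbb T)$: all $m\in C(\mathbb T)$ such that $mf\in U(\mathbb T)$ for every $f\in U(\mathbb T)$, with norm $\|m\|_{MU(\mathbb T)}=\sup_{\|f\|_{U(\mathbb T)}\le1}\|mf\|_{U(\mathbb T)}$. *)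

(* Defs.v *)
(* A function on R/(2 pi Z) is represented by a
   2 pi-periodic function R -> C, periodicity being part of [inC].  Norms are
   Rbar-valued suprema, so that they are meaningful without any boundedness
   hypothesis. *)
From Stdlib Require Import Reals ZArith.
From Coquelicot Require Import Coquelicot.
Open Scope R_scope.

Definition periodic (f : R -> C) : Prop := forall t : R, f (t + 2 * PI) = f t.

Definition inC (f : R -> C) : Prop :=
  periodic f /\ forall t : R, continuous f t.

Definition normC (f : R -> C) : Rbar :=
  Lub_Rbar (fun r : R => exists t : R, r = Cmod (f t)).

(* e^{ix} *)
Definition cis (x : R) : C := (cos x, sin x).

Definition fourier (f : R -> C) (k : Z) : C :=
  (RtoC (/ (2 * PI)) *
   RInt (V := C_R_CompleteNormedModule)
     (fun t : R => f t * cis (- (IZR k * t))) 0 (2 * PI))%C.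

(* [sum_n _ (2 * N)] has the 2N+1 terms j = 0, ..., 2N, so that k = j - N runs
   through -N, ..., N. *)
Definition S_ (N : nat) (f : R -> C) (t : R) : C :=
  sum_n (fun j : nat =>
           let k := (Z.of_nat j - Z.of_nat N)%Z in
           (fourier f k * cis (IZR k * t))%C) (2 * N).

Definition inU (f : R -> C) : Prop :=
  inC f /\
  forall eps : posreal,
    eventually (fun N : nat =>
      Rbar_lt (normC (fun t : R => (f t - S_ N f t)%C)) (Finite eps)).

Definition normU (f : R -> C) : Rbar := Sup_seq (fun N : nat => normC (S_ N f)).

Definition pmul (m f : R -> C) : R -> C := fun t : R => (m t * f t)%C.

Definition inMU (m : R -> C) : Prop :=
  inC m /\ forall f : R -> C, inU f -> inU (pmul m f).

Definition normMU (m : R -> C) : Rbar :=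
  Rbar_lub (fun r : Rbar =>
    exists f : R -> C,
      inU f /\ Rbar_le (normU f) (Finite 1) /\ r = normU (pmul m f)).

(* The supremum is finite for m in C(T) and delta >= 0, the only case used, so
   [real] loses nothing. *)
Definition modulus (m : R -> C) (delta : R) : R :=
  real (Lub_Rbar (fun r : R =>
    exists t1 t2 : R, Rabs (t1 - t2) <= delta /\ r = Cmod (m t1 - m t2)%C)).

(* Main.v *)
(* Write [S_N (m f) (t) - m(t) S_N f (t)] as [1/(2 pi)] times the integral over [0, pi] of
   [D_N(s) G_t(s)], where [D_N] is the Dirichlet kernel and
   [G_t(s) = (m(t+s) - m(t)) f(t+s) + (m(t-s) - m(t)) f(t-s)].  Since [|D_N(s)| <= pi/s] and
   [|G_t(s)| <= 2 |f| omega(m,s)], this commutator is at most [|f|_C] times the Dini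
   integral, which gives the norm bound because [|f|_C <= |f|_U].  For the uniform convergence
   of [S_N (m f)], the integral over [0, d] is small by the same estimate, and the integral
   over [d, pi] tends to 0 uniformly in [t] by the Riemann-Lebesgue lemma for a bounded
   equicontinuous family. *)
Require Import Defs.
From Stdlib Require Import Reals ZArith Lra Lia.
From Coquelicot Require Import Coquelicot.
Open Scope R_scope.

(** * Continuity and Riemann integration of complex-valued functions *)

Notation CInt := (RInt (V := C_R_CompleteNormedModule)).
Notation ex_CInt := (ex_RInt (V := C_R_CompleteNormedModule)).
Notation is_CInt := (is_RInt (V := C_R_CompleteNormedModule)).

(** Bridge from the library's norm estimates for integrals to [Cmod]: the product norm on pairs is
    the same square root, up to absolute values under the squares. *)
Lemma Cmod_C_R_norm (z : C) : norm (z : C_R_NormedModule) = Cmod z.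
Proof.
  change (sqrt (Rabs (fst z) ^ 2 + Rabs (snd z) ^ 2) = Cmod z).
  now rewrite !pow2_abs.
Qed.

Lemma Cmod_sub_sym (x y : C) : Cmod (x - y) = Cmod (y - x).
Proof. replace (x - y)%C with (- (y - x))%C by ring; apply Cmod_opp. Qed.

Lemma Cmod_sub_triangle (x y : C) : Cmod (x - y) <= Cmod x + Cmod y.
Proof. unfold Cminus; rewrite <- (Cmod_opp y); apply Cmod_triangle. Qed.

Lemma continuous_C_pair (f : R -> C) (t : R) :
  continuous (fun s => fst (f s)) t -> continuous (fun s => snd (f s)) t ->
  continuous f t.
Proof.
  intros H1 H2.
  apply (continuous_ext (fun s => (fst (f s), snd (f s)))).
  { intros s; now destruct (f s). }
  apply (continuous_comp_2 _ _ (fun x y : R => (x, y) : C) t H1 H2).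
  apply (continuous_ext (fun p => p)); [now intros [x y] | apply continuous_id].
Qed.

Lemma continuous_C_fst (f : R -> C) (t : R) :
  continuous f t -> continuous (fun s => fst (f s)) t.
Proof. intros H; apply (continuous_comp f fst); [exact H | apply continuous_fst]. Qed.

Lemma continuous_C_snd (f : R -> C) (t : R) :
  continuous f t -> continuous (fun s => snd (f s)) t.
Proof. intros H; apply (continuous_comp f snd); [exact H | apply continuous_snd]. Qed.

Lemma continuous_Cmult (f g : R -> C) (t : R) :
  continuous f t -> continuous g t -> continuous (fun s => (f s * g s)%C) t.
Proof.
  intros Hf Hg.
  pose proof (continuous_C_fst _ _ Hf) as Hf1; pose proof (continuous_C_snd _ _ Hf) as Hf2.
  pose proof (continuous_C_fst _ _ Hg) as Hg1; pose proof (continuous_C_snd _ _ Hg) as Hg2.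
  apply continuous_C_pair; simpl.
  - apply (continuous_minus (V := R_NormedModule)); now apply (continuous_mult (K := R_AbsRing)).
  - apply (continuous_plus (V := R_NormedModule)); now apply (continuous_mult (K := R_AbsRing)).
Qed.

Lemma continuous_Cplus (f g : R -> C) (t : R) :
  continuous f t -> continuous g t -> continuous (fun s => (f s + g s)%C) t.
Proof. intros Hf Hg; exact (continuous_plus (V := C_R_NormedModule) f g t Hf Hg). Qed.

Lemma continuous_RtoC (f : R -> R) (t : R) :
  continuous f t -> continuous (fun s => RtoC (f s)) t.
Proof. intros H; apply continuous_C_pair; [exact H | apply continuous_const]. Qed.

Lemma continuous_shift (f : R -> C) (t : R) :
  (forall x, continuous f x) -> forall s, continuous (fun s => f (t + s)) s.
Proof.
  intros H s; apply (continuous_comp (fun s => t + s) f); [|apply H].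
  apply (continuous_plus (V := R_NormedModule)); [apply continuous_const | apply continuous_id].
Qed.

Lemma continuous_reflect (f : R -> C) (t : R) :
  (forall x, continuous f x) -> forall s, continuous (fun s => f (t - s)) s.
Proof.
  intros H s; apply (continuous_comp (fun s => t - s) f); [|apply H].
  apply (continuous_minus (V := R_NormedModule)); [apply continuous_const | apply continuous_id].
Qed.

Lemma ex_CInt_continuous (f : R -> C) (a b : R) :
  (forall s, continuous f s) -> ex_CInt f a b.
Proof. intros H; apply ex_RInt_continuous; intros z _; apply H. Qed.

(** The module [C_R_NormedModule] has only real scalars, so a complex factor is treated through real
    and imaginary parts, each a real linear combination of the two component integrals. *)
Lemma is_CInt_Cmult_l (z : C) (f : R -> C) (a b : R) (l : C) :
  is_CInt f a b l -> is_CInt (fun s => (z * f s)%C) a b (z * l)%C.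
Proof.
  intros H.
  pose proof (is_RInt_fct_extend_fst (U := R_NormedModule) (V := R_NormedModule) f a b l H) as H1.
  pose proof (is_RInt_fct_extend_snd (U := R_NormedModule) (V := R_NormedModule) f a b l H) as H2.
  apply (is_RInt_fct_extend_pair (U := R_NormedModule) (V := R_NormedModule)
    (fun s => (z * f s)%C)); simpl.
  - apply (is_RInt_minus (V := R_NormedModule)); now apply (is_RInt_scal (V := R_NormedModule)).
  - apply (is_RInt_plus (V := R_NormedModule)); now apply (is_RInt_scal (V := R_NormedModule)).
Qed.

Lemma is_CInt_sum_n (F : nat -> R -> C) (l : nat -> C) (a b : R) (n : nat) :
  (forall j, is_CInt (F j) a b (l j)) ->
  is_CInt (fun s => sum_n (fun j => F j s) n) a b (sum_n l n).
Proof.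
  intros H; induction n as [|n IH].
  - rewrite sum_O; apply is_RInt_ext with (f := F 0%nat); [|apply H].
    intros x _; now rewrite sum_O.
  - rewrite sum_Sn.
    apply is_RInt_ext with (f := fun s => plus (sum_n (fun j => F j s) n : C) (F (S n) s)).
    { intros x _; now rewrite sum_Sn. }
    apply (is_RInt_plus (V := C_R_NormedModule)); [exact IH | apply H].
Qed.

Lemma Cmod_CInt_le (f : R -> C) (g : R -> R) (a b : R) :
  a <= b -> (forall x, a <= x <= b -> Cmod (f x) <= g x) ->
  ex_CInt f a b -> ex_RInt g a b -> Cmod (CInt f a b) <= RInt g a b.
Proof.
  intros Hab Hle Hf Hg; rewrite <- Cmod_C_R_norm.
  apply (norm_RInt_le (V := C_R_NormedModule) f g a b); auto.
  - intros x Hx; rewrite Cmod_C_R_norm; auto.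
  - exact (RInt_correct (V := C_R_CompleteNormedModule) f a b Hf).
  - now apply (RInt_correct (V := R_CompleteNormedModule)).
Qed.

Lemma Cmod_CInt_le_const (f : R -> C) (K a b : R) :
  a <= b -> (forall x, a <= x <= b -> Cmod (f x) <= K) ->
  ex_CInt f a b -> Cmod (CInt f a b) <= (b - a) * K.
Proof.
  intros Hab Hle Hf; rewrite <- Cmod_C_R_norm.
  apply (norm_RInt_le_const (V := C_R_NormedModule) f a b); auto.
  - intros x Hx; rewrite Cmod_C_R_norm; auto.
  - exact (RInt_correct (V := C_R_CompleteNormedModule) f a b Hf).
Qed.

Lemma CInt_Chasles (f : R -> C) (a b c : R) :
  ex_CInt f a b -> ex_CInt f b c ->
  (CInt f a b + CInt f b c)%C = CInt f a c.
Proof. exact (RInt_Chasles (V := C_R_CompleteNormedModule) f a b c). Qed.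

Lemma CInt_plus (f g : R -> C) (a b : R) :
  ex_CInt f a b -> ex_CInt g a b ->
  CInt (fun s => (f s + g s)%C) a b = (CInt f a b + CInt g a b)%C.
Proof. exact (RInt_plus (V := C_R_CompleteNormedModule) f g a b). Qed.

Lemma CInt_minus (f g : R -> C) (a b : R) :
  ex_CInt f a b -> ex_CInt g a b ->
  CInt (fun s => (f s - g s)%C) a b = (CInt f a b - CInt g a b)%C.
Proof. exact (RInt_minus (V := C_R_CompleteNormedModule) f g a b). Qed.

Lemma CInt_Cmult_l (z : C) (f : R -> C) (a b : R) :
  ex_CInt f a b -> CInt (fun s => (z * f s)%C) a b = (z * CInt f a b)%C.
Proof.
  intros H; apply (is_RInt_unique (V := C_R_CompleteNormedModule)), is_CInt_Cmult_l.
  exact (RInt_correct (V := C_R_CompleteNormedModule) f a b H).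
Qed.

Lemma CInt_translate (f : R -> C) (v a b : R) :
  ex_CInt f (a + v) (b + v) ->
  CInt (fun s => f (s + v)) a b = CInt f (a + v) (b + v).
Proof.
  intros H.
  pose proof (RInt_comp_lin (V := C_R_CompleteNormedModule) f 1 v a b) as E.
  rewrite !Rmult_1_l in E; rewrite <- E by exact H.
  apply RInt_ext; intros x _; rewrite Rmult_1_l; symmetry; apply (scal_one (V := C_R_NormedModule)).
Qed.

(** The substitution of slope -1 produces a minus sign and reversed endpoints, and the two
    cancel. *)
Lemma CInt_reflect (f : R -> C) (v a b : R) :
  (forall s, continuous f s) ->
  CInt (fun s => f (v - s)) a b = CInt f (v - b) (v - a).
Proof.
  intros H.
  pose proof (RInt_comp_lin (V := C_R_CompleteNormedModule) f (-1) v a b) as E.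
  specialize (E ltac:(now apply ex_CInt_continuous)).
  replace (-1 * a + v) with (v - a) in E by ring; replace (-1 * b + v) with (v - b) in E by ring.
  rewrite <- (opp_RInt_swap (V := C_R_CompleteNormedModule) f) by now apply ex_CInt_continuous.
  rewrite <- E, <- (RInt_opp (V := C_R_CompleteNormedModule)).
  - apply RInt_ext; intros x _; replace (-1 * x + v) with (v - x) by ring.
    rewrite (scal_opp_one (V := C_R_NormedModule)); symmetry; apply (opp_opp (G := C_R_NormedModule)).
  - apply ex_CInt_continuous; intros s.
    apply (continuous_scal_r (V := C_R_NormedModule)).
    apply (continuous_comp (fun y => -1 * y + v) f); [|apply H].
    apply (continuous_plus (V := R_NormedModule)); [|apply continuous_const].
    apply (continuous_mult (K := R_AbsRing)); [apply continuous_const | apply continuous_id].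
Qed.

(** Restates an equality at the carrier of an algebraic structure as one in [C], where [ring]
    applies. *)
Ltac C_ring := match goal with |- @eq _ ?a ?b => change (@eq C a b); ring end.

(** * Characters and the Dirichlet kernel *)

Lemma cis_add (x y : R) : cis (x + y) = (cis x * cis y)%C.
Proof. unfold cis; rewrite cos_plus, sin_plus; unfold Cmult; simpl; f_equal; ring. Qed.

Lemma cis_continuous (x : R) : continuous cis x.
Proof. apply continuous_C_pair; simpl; [apply continuous_cos | apply continuous_sin]. Qed.

(** The real form 1 + 2 cos s + ... + 2 cos (N s) of the kernel, recursive so that its properties
    follow by induction and no division by sin (s/2) occurs. *)
Fixpoint dirichlet (N : nat) (s : R) : R :=
  match N with
  | O => 1
  | S n => dirichlet n s + 2 * cos (INR (S n) * s)
  end.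

(** Passing from N to N + 1 adds one frequency at each end of the symmetric sum. *)
Lemma sum_n_ends (a : nat -> C) (n : nat) :
  sum_n a (S (S n)) = (a 0%nat + sum_n (fun j => a (S j)) n + a (S (S n)))%C.
Proof.
  rewrite sum_Sn; f_equal.
  unfold sum_n; rewrite sum_Sn_m by lia; now rewrite sum_n_m_S.
Qed.

Lemma sum_cis_dirichlet (N : nat) (s : R) :
  sum_n (fun j : nat => cis (IZR (Z.of_nat j - Z.of_nat N) * s)) (2 * N)
  = RtoC (dirichlet N s).
Proof.
  induction N as [|N IH].
  - rewrite sum_O; simpl; unfold cis, RtoC; now rewrite Rmult_0_l, cos_0, sin_0.
  - replace (2 * S N)%nat with (S (S (2 * N))) by lia.
    rewrite sum_n_ends.
    (* Since (j + 1) - (N + 1) = j - N, the inner block is the sum for N. *)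
    rewrite (sum_n_ext _ (fun j : nat => cis (IZR (Z.of_nat j - Z.of_nat N) * s))).
    2:{ intros j; do 3 f_equal; lia. }
    rewrite IH.
    replace (Z.of_nat 0 - Z.of_nat (S N))%Z with (- Z.of_nat (S N))%Z by lia.
    replace (Z.of_nat (S (S (2 * N))) - Z.of_nat (S N))%Z with (Z.of_nat (S N)) by lia.
    rewrite opp_IZR, <- INR_IZR_INZ, Ropp_mult_distr_l_reverse.
    unfold cis; rewrite cos_neg, sin_neg; cbn [dirichlet].
    unfold RtoC, Cplus; cbn [fst snd]; f_equal; ring.
Qed.

Lemma dirichlet_continuous (N : nat) (s : R) : continuous (dirichlet N) s.
Proof.
  induction N as [|N IH]; [apply continuous_const|].
  apply (continuous_plus (V := R_NormedModule) _ (fun s => 2 * cos (INR (S N) * s))); [exact IH|].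
  apply (continuous_mult (K := R_AbsRing) (fun _ => 2)); [apply continuous_const|].
  apply (continuous_comp (fun s => INR (S N) * s) cos); [|apply continuous_cos].
  apply (continuous_mult (K := R_AbsRing)); [apply continuous_const | apply continuous_id].
Qed.

Lemma dirichlet_even (N : nat) (s : R) : dirichlet N (- s) = dirichlet N s.
Proof.
  induction N as [|N IH]; [reflexivity|]; cbn [dirichlet].
  now rewrite IH, Ropp_mult_distr_r_reverse, cos_neg.
Qed.

Lemma dirichlet_periodic (N : nat) (s : R) : dirichlet N (s + 2 * PI) = dirichlet N s.
Proof.
  induction N as [|N IH]; [reflexivity|]; cbn [dirichlet].
  rewrite IH.
  replace (INR (S N) * (s + 2 * PI)) with (INR (S N) * s + 2 * INR (S N) * PI) by ring.
  now rewrite cos_period.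
Qed.

(** Telescoping: 2 sin (s/2) cos (n s) = sin ((n + 1/2) s) - sin ((n - 1/2) s). *)
Lemma sin_half_dirichlet (N : nat) (s : R) :
  sin (s / 2) * dirichlet N s = sin ((INR N + / 2) * s).
Proof.
  induction N as [|N IH]; cbn [dirichlet].
  - simpl INR; rewrite Rmult_1_r; f_equal; field.
  - rewrite Rmult_plus_distr_l, IH, S_INR.
    replace ((INR N + / 2) * s) with ((INR N + 1) * s - s / 2) by field.
    replace ((INR N + 1 + / 2) * s) with ((INR N + 1) * s + s / 2) by field.
    rewrite sin_minus, sin_plus; ring.
Qed.

(* A chord slope of sin on [0, x] below 2/pi forces one above 2/pi on [x, pi/2],
   contradicting that cos decreases. *)
Lemma sin_ge_chord (x : R) : 0 <= x <= PI / 2 -> 2 * x / PI <= sin x.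
Proof.
  intros Hx; pose proof PI_RGT_0.
  destruct (Req_dec x 0) as [->|H0]; [rewrite sin_0; unfold Rdiv; lra|].
  destruct (Req_dec x (PI / 2)) as [->|H1]; [rewrite sin_PI2; right; field; lra|].
  apply Rnot_lt_le; intros Hlt.
  assert (D : forall c, derivable_pt_lim sin c (cos c)) by apply derivable_pt_lim_sin.
  destruct (MVT_cor2 sin cos 0 x) as (c1 & E1 & B1); [lra | auto |].
  destruct (MVT_cor2 sin cos x (PI / 2)) as (c2 & E2 & B2); [lra | auto |].
  rewrite sin_0 in E1; rewrite sin_PI2 in E2.
  assert (C1 : cos c1 < 2 / PI).
  { apply Rmult_lt_reg_r with x; [lra|]. unfold Rdiv in *; lra. }
  assert (C2 : 2 / PI < cos c2).
  { apply Rmult_lt_reg_r with (PI / 2 - x); [lra|].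
    replace (2 / PI * (PI / 2 - x)) with (1 - 2 * x / PI) by (field; lra). lra. }
  pose proof (cos_decreasing_1 c1 c2). lra.
Qed.

(** The chord bound gives sin (s/2) >= s/pi, while the product with sin (s/2) is a sine and hence at
    most 1 in absolute value. *)
Lemma dirichlet_bound (N : nat) (s : R) :
  0 < s <= PI -> Rabs (dirichlet N s) <= PI / s.
Proof.
  intros Hs; pose proof PI_RGT_0.
  pose proof (sin_ge_chord (s / 2) ltac:(lra)) as Hl.
  replace (2 * (s / 2) / PI) with (s / PI) in Hl by (field; lra).
  pose proof (f_equal Rabs (sin_half_dirichlet N s)) as E.
  assert (0 < s / PI) by (apply Rdiv_lt_0_compat; lra).
  rewrite Rabs_mult, (Rabs_pos_eq (sin (s / 2))) in E by lra.
  pose proof (proj2 (Rabs_le_between (sin ((INR N + / 2) * s)) 1) (SIN_bound _)) as B.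
  assert (s / PI * Rabs (dirichlet N s) <= 1).
  { rewrite <- E in B; apply Rle_trans with (2 := B).
    apply Rmult_le_compat_r; [apply Rabs_pos | exact Hl]. }
  apply Rmult_le_reg_l with (s / PI); [lra|].
  replace (s / PI * (PI / s)) with 1 by (field; lra). lra.
Qed.

(** * Partial sums as integrals against the Dirichlet kernel *)

(** Cut at 0 and 2 pi: the piece from 2 pi to c + 2 pi is a translate of the one from 0 to c and
    cancels the one from c to 0. Integrals are oriented, so the sign of c does not matter. *)
Lemma CInt_period (f : R -> C) (c : R) :
  inC f -> CInt f c (c + 2 * PI) = CInt f 0 (2 * PI).
Proof.
  intros [Hp Hc].
  assert (E : forall a b, ex_CInt f a b) by (intros; now apply ex_CInt_continuous).
  rewrite <- (CInt_Chasles f c 0 (c + 2 * PI)), <- (CInt_Chasles f 0 (2 * PI) (c + 2 * PI)) by auto.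
  assert (T : CInt f (2 * PI) (c + 2 * PI) = CInt f 0 c).
  { rewrite <- (Rplus_0_l (2 * PI)) at 1; rewrite <- CInt_translate by apply E.
    apply RInt_ext; intros x _; apply Hp. }
  rewrite T.
  replace (CInt f c 0) with (- CInt f 0 c)%C.
  - C_ring.
  - exact (opp_RInt_swap (V := C_R_CompleteNormedModule) f 0 c (E 0 c)).
Qed.

Lemma S_convolution (N : nat) (f : R -> C) (t : R) :
  inC f ->
  S_ N f t = (RtoC (/ (2 * PI)) * CInt (fun u => f u * RtoC (dirichlet N (t - u)))%C 0 (2 * PI))%C.
Proof.
  intros [_ Hc].
  set (k := fun j => IZR (Z.of_nat j - Z.of_nat N)).
  set (I := fun j => CInt (fun u => f u * cis (- (k j * u)))%C 0 (2 * PI)).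
  unfold S_, fourier.
  rewrite (sum_n_ext _ (fun j => mult (RtoC (/ (2 * PI)) : C_Ring) (cis (k j * t) * I j)%C)).
  2:{ intros j; change mult with Cmult; unfold I, k; C_ring. }
  rewrite (sum_n_mult_l (K := C_Ring)); change mult with Cmult.
  f_equal; symmetry.
  apply (is_RInt_unique (V := C_R_CompleteNormedModule)).
  apply is_RInt_ext with
    (f := fun u => sum_n (fun j => cis (k j * t) * (f u * cis (- (k j * u))))%C (2 * N)).
  - intros u _; rewrite <- sum_cis_dirichlet.
    rewrite (sum_n_ext _ (fun j => mult (f u : C_Ring) (cis (k j * (t - u))))).
    2:{ intros j; change mult with Cmult.
        replace (k j * (t - u)) with (k j * t + - (k j * u)) by ring.
        rewrite cis_add; C_ring. }
    now rewrite (sum_n_mult_l (K := C_Ring)).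
  - apply is_CInt_sum_n; intros j; apply is_CInt_Cmult_l.
    apply (RInt_correct (V := C_R_CompleteNormedModule)), ex_CInt_continuous; intros s.
    apply continuous_Cmult; [apply Hc|].
    apply (continuous_comp (fun u => - (k j * u)) cis); [|apply cis_continuous].
    apply (continuous_opp (V := R_NormedModule)).
    apply (continuous_mult (K := R_AbsRing)); [apply continuous_const | apply continuous_id].
Qed.

(** Move the period to [t - pi, t + pi], cut it at t, and fold the two halves together by evenness
    of the kernel. *)
Lemma S_dirichlet (N : nat) (f : R -> C) (t : R) :
  inC f ->
  S_ N f t = (RtoC (/ (2 * PI)) *
              CInt (fun s => RtoC (dirichlet N s) * (f (t + s)%R + f (t - s)%R))%C 0 PI)%C.
Proof.
  intros Hf; rewrite S_convolution by exact Hf; destruct Hf as [Hp Hc]; f_equal.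
  set (H := fun u => (f u * RtoC (dirichlet N (t - u)))%C).
  assert (Hk : forall s, continuous (fun u => dirichlet N (t - u)) s).
  { intros s; apply (continuous_comp (fun u => t - u)); [|apply dirichlet_continuous].
    apply (continuous_minus (V := R_NormedModule)); [apply continuous_const | apply continuous_id]. }
  assert (HH : forall s, continuous H s).
  { intros s; apply continuous_Cmult; [apply Hc | apply continuous_RtoC, Hk]. }
  assert (HP : periodic H).
  { intros s; unfold H; rewrite Hp, <- (dirichlet_periodic N (t - (s + 2 * PI))).
    do 3 f_equal; ring. }
  assert (E : forall a b, ex_CInt H a b) by (intros; now apply ex_CInt_continuous).
  rewrite <- (CInt_period H (t - PI)) by (split; assumption).
  rewrite <- (CInt_Chasles H _ t) by auto.
  transitivity (CInt (fun s => H (t - s)%R) 0 PI + CInt (fun s => H (s + t)%R) 0 PI)%C.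
  - rewrite CInt_reflect, CInt_translate by auto.
    f_equal; f_equal; ring.
  - rewrite <- CInt_plus.
    + apply RInt_ext; intros s _; unfold H.
      replace (t - (t - s)) with s by ring; replace (t - (s + t)) with (- s) by ring.
      rewrite dirichlet_even, (Rplus_comm s t); C_ring.
    + apply ex_CInt_continuous; now apply continuous_reflect.
    + apply ex_CInt_continuous; intros s.
      apply continuous_ext with (fun s => H (t + s)); [intros x; f_equal; ring|].
      now apply continuous_shift.
Qed.

(** * Boundedness and uniform continuity of continuous periodic functions *)

Lemma periodic_Z (f : R -> C) (k : Z) (t : R) :
  periodic f -> f (t + 2 * PI * IZR k) = f t.
Proof.
  intros Hp.
  assert (N : forall (n : nat) s, f (s + 2 * PI * INR n) = f s).
  { intros n; induction n as [|n IH]; intros s.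
    - simpl; f_equal; ring.
    - rewrite S_INR; replace (s + 2 * PI * (INR n + 1)) with (s + 2 * PI * INR n + 2 * PI) by ring.
      now rewrite Hp. }
  destruct (Z_le_gt_dec 0 k) as [Hk|Hk].
  - rewrite <- (Z2Nat.id k), <- INR_IZR_INZ by lia; apply N.
  (* For negative k, walk forward by -k periods from the translated point. *)
  - rewrite <- (N (Z.to_nat (- k)) (t + 2 * PI * IZR k)).
    rewrite INR_IZR_INZ, Z2Nat.id, opp_IZR by lia; f_equal; ring.
Qed.

Lemma period_reduction (t : R) : exists k : Z, 0 <= t + 2 * PI * IZR k <= 2 * PI.
Proof.
  pose proof PI_RGT_0.
  (* As q < up q <= q + 1, this shift moves q = t/(2 pi) into [0, 1). *)
  exists (1 - up (t / (2 * PI)))%Z; rewrite minus_IZR.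
  destruct (archimed (t / (2 * PI))) as [H1 H2].
  set (u := IZR (up (t / (2 * PI)))) in *.
  assert (E : t = t / (2 * PI) * (2 * PI)) by (field; lra).
  set (q := t / (2 * PI)) in *; nra.
Qed.

Lemma inC_bounded (f : R -> C) : inC f -> exists K, 0 <= K /\ forall t, Cmod (f t) <= K.
Proof.
  intros [Hp Hc].
  destruct (bounded_continuity (V := C_R_NormedModule) f 0 (2 * PI)) as [K HK].
  { intros x _; apply Hc. }
  assert (B : forall t, Cmod (f t) <= K).
  { intros t; destruct (period_reduction t) as [k Hk].
    rewrite <- (periodic_Z f k t Hp), <- Cmod_C_R_norm; now apply Rlt_le, HK. }
  exists K; split; [|exact B].
  apply Rle_trans with (2 := B 0), Cmod_ge_0.
Qed.

Lemma inC_unif (f : R -> C) : inC f ->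
  forall eps, 0 < eps -> exists d, 0 < d /\
    forall x y, Rabs (x - y) <= d -> Cmod (f x - f y) <= eps.
Proof.
  intros [Hp Hc] eps He; pose proof PI_RGT_0.
  (* A margin of 1 on both sides of a period: with d <= 1, the translation that brings x into
     [0, 2 pi] keeps y inside the larger interval. *)
  destruct (unifcont_normed_1d (V := C_R_NormedModule) f (-1) (2 * PI + 1) (fun x _ => Hc x)
              (mkposreal eps He)) as [d Hd].
  exists (Rmin 1 (d / 2)); pose proof (cond_pos d); split; [apply Rmin_glb_lt; lra|].
  intros x y Hxy; destruct (period_reduction x) as [k Hk].
  pose proof (Rmin_l 1 (d / 2)); pose proof (Rmin_r 1 (d / 2)).
  apply Rabs_le_between in Hxy.
  rewrite <- (periodic_Z f k x Hp), <- (periodic_Z f k y Hp), Cmod_sub_sym, <- Cmod_C_R_norm.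
  apply Rlt_le, Hd; try lra.
  apply Rabs_def1; simpl; unfold minus, plus, opp; simpl; lra.
Qed.

(** * Equicontinuous families and the Riemann-Lebesgue lemma *)

(** Uniform boundedness together with uniform equicontinuity on [a, b]. The index will be the base
    point t, so that estimates for a family are uniform in t. *)
Definition equi {I : Type} (a b : R) (g : I -> R -> C) : Prop :=
  (exists K, 0 <= K /\ forall i s, a <= s <= b -> Cmod (g i s) <= K) /\
  forall eps, 0 < eps -> exists d, 0 < d /\
    forall i s s', a <= s <= b -> a <= s' <= b -> Rabs (s - s') <= d ->
    Cmod (g i s - g i s') <= eps.

Lemma equi_plus {I : Type} (a b : R) (f g : I -> R -> C) :
  equi a b f -> equi a b g -> equi a b (fun i s => f i s + g i s)%C.
Proof.
  intros [(K & HK & Bf) Uf] [(L & HL & Bg) Ug]; split.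
  - exists (K + L); split; [lra|]; intros i s Hs.
    apply Rle_trans with (1 := Cmod_triangle _ _); apply Rplus_le_compat; auto.
  - intros eps He.
    destruct (Uf (eps / 2)) as (d & Hd & Df); [lra|].
    destruct (Ug (eps / 2)) as (e & He' & Dg); [lra|].
    exists (Rmin d e); split; [now apply Rmin_glb_lt|]; intros i s s' Hs Hs' Hss.
    pose proof (Rmin_l d e); pose proof (Rmin_r d e).
    replace (f i s + g i s - (f i s' + g i s'))%C
      with ((f i s - f i s') + (g i s - g i s'))%C by ring.
    apply Rle_trans with (1 := Cmod_triangle _ _).
    specialize (Df i s s' Hs Hs'); specialize (Dg i s s' Hs Hs'); lra.
Qed.

Lemma equi_mult {I : Type} (a b : R) (f g : I -> R -> C) :
  equi a b f -> equi a b g -> equi a b (fun i s => f i s * g i s)%C.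
Proof.
  intros [(K & HK & Bf) Uf] [(L & HL & Bg) Ug]; split.
  - exists (K * L); split; [now apply Rmult_le_pos|]; intros i s Hs.
    rewrite Cmod_mult; apply Rmult_le_compat; auto using Cmod_ge_0.
  - intros eps He.
    (* Chosen so that r L + K r <= eps; the 1 keeps the denominator positive. *)
    set (r := eps / (K + L + 1)).
    assert (Hr : 0 < r) by (apply Rdiv_lt_0_compat; lra).
    assert (Er : r * (K + L + 1) = eps) by (unfold r; field; lra).
    destruct (Uf r) as (d & Hd & Df); [lra|].
    destruct (Ug r) as (e & He' & Dg); [lra|].
    exists (Rmin d e); split; [now apply Rmin_glb_lt|]; intros i s s' Hs Hs' Hss.
    pose proof (Rmin_l d e); pose proof (Rmin_r d e).
    replace (f i s * g i s - f i s' * g i s')%C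
      with ((f i s - f i s') * g i s + f i s' * (g i s - g i s'))%C by ring.
    apply Rle_trans with (1 := Cmod_triangle _ _); rewrite !Cmod_mult.
    apply Rle_trans with (r * L + K * r); [|nra].
    apply Rplus_le_compat; apply Rmult_le_compat; auto using Cmod_ge_0.
    + apply Df; auto; lra.
    + apply Dg; auto; lra.
Qed.

Lemma equi_const {I : Type} (a b : R) (c : I -> C) (K : R) :
  0 <= K -> (forall i, Cmod (c i) <= K) -> equi a b (fun i _ => c i).
Proof.
  intros HK Hc; split; [exists K; auto|].
  intros eps He; exists 1; split; [lra|]; intros i s s' _ _ _.
  replace (c i - c i)%C with (RtoC 0) by ring; rewrite Cmod_0; lra.
Qed.

Lemma equi_single {I : Type} (a b : R) (f : R -> C) :
  a <= b -> (forall s, a <= s <= b -> continuous f s) -> equi a b (fun (_ : I) s => f s).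
Proof.
  intros Hab Hc; split.
  - destruct (bounded_continuity (V := C_R_NormedModule) f a b Hc) as [K HK].
    assert (B : forall s, a <= s <= b -> Cmod (f s) <= K).
    { intros s Hs; rewrite <- Cmod_C_R_norm; now apply Rlt_le, HK. }
    exists K; split; [|intros _; exact B].
    apply Rle_trans with (2 := B a ltac:(lra)), Cmod_ge_0.
  - intros eps He.
    destruct (unifcont_normed_1d (V := C_R_NormedModule) f a b Hc (mkposreal eps He)) as [d Hd].
    pose proof (cond_pos d); exists (d / 2); split; [lra|]; intros _ x y Hx Hy Hxy.
    apply Rabs_le_between in Hxy.
    rewrite Cmod_sub_sym, <- Cmod_C_R_norm; apply Rlt_le, Hd; auto.
    apply Rabs_def1; simpl; unfold minus, plus, opp; simpl; lra.
Qed.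

Lemma equi_shift (a b : R) (f : R -> C) : inC f -> equi a b (fun t s => f (t + s)).
Proof.
  intros Hf; split.
  - destruct (inC_bounded f Hf) as (K & HK & B); exists K; auto.
  - intros eps He; destruct (inC_unif f Hf eps He) as (d & Hd & D).
    exists d; split; [exact Hd|]; intros t s s' _ _ H; apply D.
    now replace (t + s - (t + s')) with (s - s') by ring.
Qed.

Lemma equi_reflect (a b : R) (f : R -> C) : inC f -> equi a b (fun t s => f (t - s)).
Proof.
  intros Hf; split.
  - destruct (inC_bounded f Hf) as (K & HK & B); exists K; auto.
  - intros eps He; destruct (inC_unif f Hf eps He) as (d & Hd & D).
    exists d; split; [exact Hd|]; intros t s s' _ _ H; apply D.
    rewrite Rabs_minus_sym; now replace (t - s' - (t - s)) with (s - s') by ring.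
Qed.

(* With [h = PI / lam], translating by [h] flips the sign of [sin (lam * s)], so that
   twice the integral is the integral of [(g s - g (s - h)) * sin (lam * s)] up to two
   boundary integrals over intervals of length [h]. *)
Lemma Cmod_CInt_sin_le (g : R -> C) (a b lam K eta : R) :
  0 < lam -> a <= b ->
  (forall s, a - PI / lam <= s <= b -> continuous g s) ->
  (forall s, a - PI / lam <= s <= b -> Cmod (g s) <= K) ->
  (forall s, a <= s <= b -> Cmod (g s - g (s - PI / lam)) <= eta) ->
  Cmod (CInt (fun s => RtoC (sin (lam * s)) * g s)%C a b) <= (b - a) * eta / 2 + PI / lam * K.
Proof.
  intros Hl Hab Hc HK He; pose proof PI_RGT_0.
  assert (Hh : 0 < PI / lam) by (apply Rdiv_lt_0_compat; lra).
  set (h := PI / lam) in *.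
  assert (Hs : forall v, continuous (fun s => RtoC (sin (lam * s))) v).
  { intros v; apply continuous_RtoC.
    apply (continuous_comp (fun s => lam * s) sin); [|apply continuous_sin].
    apply (continuous_mult (K := R_AbsRing)); [apply continuous_const | apply continuous_id]. }
  set (P := fun s => (RtoC (sin (lam * s)) * g s)%C).
  assert (HP : forall x y, a - h <= x <= b -> a - h <= y <= b -> ex_CInt P x y).
  { intros x y Hx Hy; apply ex_RInt_continuous; intros z Hz.
    apply continuous_Cmult; [apply Hs | apply Hc].
    revert Hz; unfold Rmin, Rmax; destruct (Rle_dec x y); lra. }
  assert (BP : forall s, a - h <= s <= b -> Cmod (P s) <= K).
  { intros s Hs'; unfold P; rewrite Cmod_mult, Cmod_R.
    rewrite <- (Rmult_1_l K); apply Rmult_le_compat; auto using Rabs_pos, Cmod_ge_0.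
    apply Rabs_le_between, SIN_bound. }
  assert (HT : ex_CInt (fun s => P (s + - h)) a b).
  { apply ex_RInt_continuous; intros z Hz.
    rewrite Rmin_left, Rmax_right in Hz by lra.
    apply (continuous_comp (fun s => s + - h) P).
    - apply (continuous_plus (V := R_NormedModule)); [apply continuous_id | apply continuous_const].
    - apply continuous_Cmult; [apply Hs | apply Hc; lra]. }
  assert (E1 : (CInt P a b + CInt P (a - h) (b - h) =
                CInt (fun s => RtoC (sin (lam * s)) * (g s - g (s - h)%R))%C a b)%C).
  { unfold Rminus at 1 2; rewrite <- CInt_translate by (apply HP; lra).
    rewrite <- CInt_plus; [|apply HP; lra | exact HT].
    apply (RInt_ext (V := C_R_CompleteNormedModule)); intros s _; unfold P.
    replace (sin (lam * (s + - h))) with (- sin (lam * s)).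
    - rewrite RtoC_opp; fold (s - h); C_ring.
    - replace (lam * (s + - h)) with (- (PI - lam * s)) by (unfold h; field; lra).
      now rewrite sin_neg, sin_PI_x. }
  assert (E2 : (CInt P (a - h) (b - h) + CInt P (b - h) b = CInt P (a - h) a + CInt P a b)%C).
  { rewrite !CInt_Chasles; auto; apply HP; lra. }
  assert (D : (RtoC 2 * CInt P a b = CInt (fun s => RtoC (sin (lam * s)) * (g s - g (s - h)%R))%C a b
                + (CInt P (b - h) b - CInt P (a - h) a))%C).
  { rewrite <- E1.
    replace (CInt P (a - h) (b - h))
      with (CInt P (a - h) a + CInt P a b - CInt P (b - h) b)%C by (rewrite <- E2; C_ring).
    C_ring. }
  assert (B1 : Cmod (CInt (fun s => RtoC (sin (lam * s)) * (g s - g (s - h)%R))%C a b) <= (b - a) * eta).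
  { apply Cmod_CInt_le_const; [exact Hab | | ].
    - intros s Hs'; rewrite Cmod_mult, Cmod_R.
      rewrite <- (Rmult_1_l eta); apply Rmult_le_compat; auto using Rabs_pos, Cmod_ge_0.
      apply Rabs_le_between, SIN_bound.
    - apply (ex_RInt_ext (V := C_R_NormedModule) (fun s => P s + P (s + - h)%R)%C).
      + intros s _; unfold P.
        replace (lam * (s + - h)) with (- (PI - lam * s)) by (unfold h; field; lra).
        rewrite sin_neg, sin_PI_x, RtoC_opp; fold (s - h); C_ring.
      + apply (ex_RInt_plus (V := C_R_NormedModule) P); [apply HP; lra | exact HT]. }
  assert (B2 : Cmod (CInt P (b - h) b) <= (b - (b - h)) * K).
  { apply Cmod_CInt_le_const; [lra | intros; apply BP; lra | apply HP; lra]. }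
  assert (B3 : Cmod (CInt P (a - h) a) <= (a - (a - h)) * K).
  { apply Cmod_CInt_le_const; [lra | intros; apply BP; lra | apply HP; lra]. }
  apply (f_equal Cmod) in D; rewrite Cmod_mult, Cmod_R, (Rabs_pos_eq 2) in D by lra.
  pose proof (Cmod_triangle (CInt (fun s => RtoC (sin (lam * s)) * (g s - g (s - h)%R))%C a b)
                (CInt P (b - h) b - CInt P (a - h) a)).
  pose proof (Cmod_sub_triangle (CInt P (b - h) b) (CInt P (a - h) a)).
  fold P; lra.
Qed.

(** Only at interior points, since [equi] says nothing outside [a, b]; the radius is cut down to
    keep neighbours inside. *)
Lemma equi_continuous {I : Type} (a b : R) (g : I -> R -> C) (i : I) (s : R) :
  equi a b g -> a < s < b -> continuous (g i) s.
Proof.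
  intros [_ U] Hs; apply (filterlim_locally_ball_norm (U := C_R_NormedModule)); intros eps.
  pose proof (cond_pos eps); destruct (U (eps / 2)) as (d & Hd & D); [lra|].
  assert (Hr : 0 < Rmin d (Rmin (s - a) (b - s))) by (repeat apply Rmin_glb_lt; lra).
  exists (mkposreal _ Hr); simpl; intros y Hy.
  pose proof (Rmin_l d (Rmin (s - a) (b - s))); pose proof (Rmin_r d (Rmin (s - a) (b - s))).
  pose proof (Rmin_l (s - a) (b - s)); pose proof (Rmin_r (s - a) (b - s)).
  apply Rabs_lt_between in Hy; unfold minus, plus, opp in Hy; simpl in Hy.
  unfold ball_norm; rewrite Cmod_C_R_norm.
  apply Rle_lt_trans with (eps / 2); [|lra].
  apply (D i y s); try lra; apply Rabs_le_between; lra.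
Qed.

(** The threshold [L] is common to all indices. The wider interval leaves room for the translate s -
    pi/lam and gives continuity at a and b. *)
Lemma riemann_lebesgue {I : Type} (a' a b b' : R) (g : I -> R -> C) :
  a' < a <= b -> b < b' -> equi a' b' g ->
  forall eps, 0 < eps -> exists L, forall lam i, L <= lam ->
    Cmod (CInt (fun s => RtoC (sin (lam * s)) * g i s)%C a b) <= eps.
Proof.
  intros Ha Hb Hg eps He; pose proof PI_RGT_0.
  destruct (Hg) as [(K & HK & B) U].
  destruct (U (eps / (b - a + 1))) as (d & Hd & D); [apply Rdiv_lt_0_compat; lra|].
  (* Three demands on the translation length: within the equicontinuity scale, inside [a', b'], and
     with boundary term h0 K at most eps/2. *)
  set (h0 := Rmin (Rmin d ((a - a') / 2)) (eps / (2 * (K + 1)))).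
  assert (H0 : 0 < h0).
  { repeat apply Rmin_glb_lt; try lra; apply Rdiv_lt_0_compat; lra. }
  assert (H1 : h0 <= d) by (eapply Rle_trans; apply Rmin_l).
  assert (H2 : h0 <= (a - a') / 2) by (eapply Rle_trans; [apply Rmin_l | apply Rmin_r]).
  assert (H3 : h0 * (2 * (K + 1)) <= eps).
  { apply Rle_trans with (eps / (2 * (K + 1)) * (2 * (K + 1))).
    - apply Rmult_le_compat_r; [lra | apply Rmin_r].
    - right; field; lra. }
  exists (PI / h0); intros lam i Hlam.
  assert (0 < PI / h0) by (apply Rdiv_lt_0_compat; lra).
  assert (Hh : PI / lam <= h0).
  { apply Rmult_le_reg_r with lam; [lra|].
    replace (PI / lam * lam) with PI by (field; lra).
    replace PI with (PI / h0 * h0) at 1 by (field; lra). rewrite Rmult_comm.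
    apply Rmult_le_compat_l; lra. }
  assert (Hh' : 0 < PI / lam) by (apply Rdiv_lt_0_compat; lra).
  eapply Rle_trans.
  { apply Cmod_CInt_sin_le with (K := K) (eta := eps / (b - a + 1)); [lra | lra | | | ].
    - intros s Hs; apply (equi_continuous a' b' g i s Hg); lra.
    - intros s Hs; apply B; lra.
    - intros s Hs; apply D; [lra | lra | ].
      replace (s - (s - PI / lam)) with (PI / lam) by ring; rewrite Rabs_pos_eq; lra. }
  assert ((b - a) * (eps / (b - a + 1)) <= eps).
  { apply Rmult_le_reg_r with (b - a + 1); [lra|].
    replace ((b - a) * (eps / (b - a + 1)) * (b - a + 1)) with ((b - a) * eps) by (field; lra). nra. }
  assert (PI / lam * K <= h0 * K) by (apply Rmult_le_compat_r; lra). nra.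
Qed.

(** * Products, the modulus of continuity and the improper Dini integral *)

Lemma inC_pmul (m f : R -> C) : inC m -> inC f -> inC (pmul m f).
Proof.
  intros [Pm Cm] [Pf Cf]; split.
  - intros t; unfold pmul; now rewrite Pm, Pf.
  - intros t; now apply continuous_Cmult.
Qed.

(** A bound K for m bounds the set by 2 K, so its supremum is finite and [real] returns it rather
    than the default 0. *)
Lemma Cmod_le_modulus (m : R -> C) (d t1 t2 : R) :
  inC m -> Rabs (t1 - t2) <= d -> Cmod (m t1 - m t2) <= modulus m d.
Proof.
  intros Hm Hd; destruct (inC_bounded m Hm) as (K & HK & B); unfold modulus.
  set (E := fun r : R => _).
  destruct (Lub_Rbar_correct E) as [Hub Hlub].
  assert (HE : E (Cmod (m t1 - m t2))) by (now exists t1, t2).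
  specialize (Hub _ HE).
  assert (Hle : Rbar_le (Lub_Rbar E) (2 * K)).
  { apply Hlub; intros r (s1 & s2 & _ & ->); simpl.
    apply Rle_trans with (1 := Cmod_sub_triangle _ _).
    pose proof (B s1); pose proof (B s2); lra. }
  destruct (Lub_Rbar E); simpl in *; [exact Hub | contradiction | contradiction].
Qed.

Lemma modulus_nonneg (m : R -> C) (d : R) : inC m -> 0 <= d -> 0 <= modulus m d.
Proof.
  intros Hm Hd; apply Rle_trans with (Cmod (m 0 - m 0)); [apply Cmod_ge_0|].
  apply Cmod_le_modulus; [exact Hm|]; now rewrite Rminus_diag, Rabs_R0.
Qed.

(** For a nonnegative integrand the integrals over [a, b] increase to the improper integral as a
    decreases to 0; what is used later is integrability, the upper bound and the approximation. *)
Lemma RInt_gen_at_right (phi : R -> R) (b : R) :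
  0 < b -> (forall s, 0 < s -> 0 <= phi s) ->
  ex_RInt_gen phi (at_right 0) (at_point b) ->
  (forall a, 0 < a <= b -> ex_RInt phi a b) /\
  (forall a, 0 < a <= b -> RInt phi a b <= RInt_gen phi (at_right 0) (at_point b)) /\
  (forall eps, 0 < eps -> exists a, 0 < a <= b /\
     RInt_gen phi (at_right 0) (at_point b) - RInt phi a b <= eps).
Proof.
  intros Hb Hpos Hex.
  pose proof (RInt_gen_correct (V := R_CompleteNormedModule) phi Hex) as H.
  set (l := RInt_gen phi (at_right 0) (at_point b)) in *.
  assert (Near : forall eps, 0 < eps -> exists d, 0 < d /\ forall y, 0 < y < d ->
            ex_RInt phi y b /\ Rabs (RInt phi y b - l) < eps).
  { intros eps He.
    (* The filter [at_point b] fixes the upper endpoint, so only the lower one moves. *)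
    destruct (proj1 (filterlimi_locally (U := R_UniformSpace) _ l) H (mkposreal eps He)) as [Q S HQ HS HQS].
    destruct HQ as [d Hd]; exists d; split; [apply cond_pos|]; intros y Hy.
    destruct (HQS y b) as (z & Hz & Bz).
    - apply Hd; [|apply Hy].
      apply Rabs_def1; unfold minus, plus, opp; simpl; lra.
    - exact HS.
    - simpl in Hz; split; [now exists z|].
      now rewrite (is_RInt_unique (V := R_CompleteNormedModule) phi y b z Hz). }
  assert (Ex : forall a, 0 < a <= b -> ex_RInt phi a b).
  { intros a Ha; destruct (Near 1) as (d & Hd & D); [lra|].
    pose proof (Rmin_l a d); pose proof (Rmin_r a d).
    assert (0 < Rmin a d) by (apply Rmin_glb_lt; lra).
    (* A point below both a and d: integrability from there to b restricts to [a, b]. *)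
    destruct (D (Rmin a d / 2)) as [E _]; [lra|].
    apply (ex_RInt_Chasles_2 (V := R_CompleteNormedModule) phi (Rmin a d / 2)); [lra | exact E]. }
  split; [exact Ex|split].
  - intros a Ha; apply le_epsilon; intros eps He.
    destruct (Near eps He) as (d & Hd & D).
    pose proof (Rmin_l a d); pose proof (Rmin_r a d).
    assert (0 < Rmin a d) by (apply Rmin_glb_lt; lra).
    destruct (D (Rmin a d / 2)) as [E B]; [lra|].
    assert (E' : ex_RInt phi (Rmin a d / 2) a).
    { apply (ex_RInt_Chasles_1 (V := R_CompleteNormedModule) phi _ a b); [lra | exact E]. }
    pose proof (RInt_Chasles (V := R_CompleteNormedModule) phi (Rmin a d / 2) a b E' (Ex a Ha)) as Ch.
    assert (0 <= RInt phi (Rmin a d / 2) a).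
    { apply RInt_ge_0; [lra | exact E' | intros; apply Hpos; lra]. }
    unfold plus in Ch; simpl in Ch; apply Rabs_lt_between in B; lra.
  - intros eps He; destruct (Near eps He) as (d & Hd & D).
    pose proof (Rmin_l b d); pose proof (Rmin_r b d).
    assert (0 < Rmin b d) by (apply Rmin_glb_lt; lra).
    exists (Rmin b d / 2); split; [lra|].
    destruct (D (Rmin b d / 2)) as [_ B]; [lra|].
    apply Rabs_lt_between in B; lra.
Qed.

(** * The commutator of multiplication by m with the partial sums *)

(** This is G_t(s) of the overview. *)
Definition commutator_kernel (m f : R -> C) (t s : R) : C :=
  ((m (t + s)%R - m t) * f (t + s)%R + (m (t - s)%R - m t) * f (t - s)%R)%C.

Lemma commutator_kernel_continuous (m f : R -> C) (t s : R) :
  inC m -> inC f -> continuous (commutator_kernel m f t) s.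
Proof.
  intros [_ Cm] [_ Cf]; unfold commutator_kernel.
  apply continuous_Cplus; apply continuous_Cmult;
    auto using continuous_shift, continuous_reflect;
    apply (continuous_minus (V := C_R_NormedModule));
    auto using continuous_shift, continuous_reflect, continuous_const.
Qed.

(** Built from translates and reflections of m and f, equicontinuous uniformly in t, and from the
    terms -m(t), constant in s and uniformly bounded. *)
Lemma equi_commutator_kernel (m f : R -> C) (a b : R) :
  inC m -> inC f -> equi a b (commutator_kernel m f).
Proof.
  intros Hm Hf.
  destruct (inC_bounded m Hm) as (K & HK & B).
  assert (Hc : equi a b (fun t (_ : R) => (- m t)%C)).
  { apply equi_const with K; [exact HK|]; intros t; now rewrite Cmod_opp. }
  apply (equi_plus a b (fun t s => (m (t + s)%R - m t) * f (t + s)%R)%C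
                       (fun t s => (m (t - s)%R - m t) * f (t - s)%R)%C).
  - apply (equi_mult a b (fun t s => m (t + s)%R + - m t)%C); [|now apply equi_shift].
    apply equi_plus; [now apply equi_shift | exact Hc].
  - apply (equi_mult a b (fun t s => m (t - s)%R + - m t)%C); [|now apply equi_reflect].
    apply equi_plus; [now apply equi_reflect | exact Hc].
Qed.

Lemma Cmod_commutator_kernel_le (m f : R -> C) (M t s : R) :
  inC m -> 0 <= M -> (forall x, Cmod (f x) <= M) -> 0 < s ->
  Cmod (commutator_kernel m f t s) <= 2 * M * modulus m s.
Proof.
  intros Hm HM Bf Hs; apply Rle_trans with (1 := Cmod_triangle _ _); rewrite !Cmod_mult.
  assert (E1 : Cmod (m (t + s)%R - m t) <= modulus m s).
  { apply Cmod_le_modulus; [exact Hm|]; replace (t + s - t) with s by ring.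
    rewrite Rabs_pos_eq; lra. }
  assert (E2 : Cmod (m (t - s)%R - m t) <= modulus m s).
  { apply Cmod_le_modulus; [exact Hm|]; replace (t - s - t) with (- s) by ring.
    rewrite Rabs_Ropp, Rabs_pos_eq; lra. }
  pose proof (Rmult_le_compat _ _ _ _ (Cmod_ge_0 _) (Cmod_ge_0 _) E1 (Bf (t + s))).
  pose proof (Rmult_le_compat _ _ _ _ (Cmod_ge_0 _) (Cmod_ge_0 _) E2 (Bf (t - s))).
  lra.
Qed.

Lemma dirichlet_commutator_kernel_continuous (m f : R -> C) (N : nat) (t s : R) :
  inC m -> inC f ->
  continuous (fun s => RtoC (dirichlet N s) * commutator_kernel m f t s)%C s.
Proof.
  intros Hm Hf; apply continuous_Cmult; [|now apply commutator_kernel_continuous].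
  apply continuous_RtoC, dirichlet_continuous.
Qed.

Lemma S_pmul_commutator (m f : R -> C) (N : nat) (t : R) :
  inC m -> inC f ->
  (S_ N (pmul m f) t - m t * S_ N f t =
   RtoC (/ (2 * PI)) * CInt (fun s => RtoC (dirichlet N s) * commutator_kernel m f t s)%C 0 PI)%C.
Proof.
  intros Hm Hf; pose proof (inC_pmul m f Hm Hf) as Hmf.
  assert (Hex : forall g : R -> C, inC g ->
            ex_CInt (fun s => RtoC (dirichlet N s) * (g (t + s)%R + g (t - s)%R))%C 0 PI).
  { intros g [_ Cg]; apply ex_CInt_continuous; intros s.
    apply continuous_Cmult; [apply continuous_RtoC, dirichlet_continuous|].
    apply continuous_Cplus; auto using continuous_shift, continuous_reflect. }
  rewrite !S_dirichlet by assumption.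
  set (A := CInt (fun s => RtoC (dirichlet N s) * (f (t + s)%R + f (t - s)%R))%C 0 PI).
  transitivity (RtoC (/ (2 * PI)) * (CInt (fun s => RtoC (dirichlet N s) *
     (pmul m f (t + s)%R + pmul m f (t - s)%R)) 0 PI - m t * A))%C; [C_ring|].
  f_equal; unfold A; rewrite <- CInt_Cmult_l, <- CInt_minus; auto.
  - apply (RInt_ext (V := C_R_CompleteNormedModule)); intros s _; unfold pmul, commutator_kernel; C_ring.
  - eexists; apply is_CInt_Cmult_l, (RInt_correct (V := C_R_CompleteNormedModule)), Hex, Hf.
Qed.

Lemma dini_quotient_nonneg (m : R -> C) (s : R) :
  inC m -> 0 < s -> 0 <= modulus m s / s.
Proof.
  intros Hm Hs; apply Rdiv_le_0_compat; [|exact Hs].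
  apply modulus_nonneg; [exact Hm | lra].
Qed.

(** The difference on the right stands for the Dini integral over (0, d]. The bound pi/s is applied
    only on [a, d]; on [0, a] the integrand is continuous, hence bounded, and contributes at most
    eps. *)
Lemma dini_head (m f : R -> C) (M : R) (N : nat) (t d : R) :
  inC m -> inC f -> 0 <= M -> (forall x, Cmod (f x) <= M) ->
  ex_RInt_gen (fun s => modulus m s / s) (at_right 0) (at_point PI) ->
  0 < d <= PI ->
  Cmod (CInt (fun s => RtoC (dirichlet N s) * commutator_kernel m f t s)%C 0 d)
  <= 2 * PI * M * (RInt_gen (fun s => modulus m s / s) (at_right 0) (at_point PI)
                   - RInt (fun s => modulus m s / s) d PI).
Proof.
  intros Hm Hf HM Bf Hex Hd; pose proof PI_RGT_0.
  set (phi := fun s => modulus m s / s) in *; set (J := RInt_gen phi (at_right 0) (at_point PI)).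
  destruct (RInt_gen_at_right phi PI PI_RGT_0 (fun s => dini_quotient_nonneg m s Hm) Hex) as (Ex & Le & _).
  fold J in Le.
  set (F := fun s => (RtoC (dirichlet N s) * commutator_kernel m f t s)%C).
  assert (HC : forall s, continuous F s).
  { intros s; now apply dirichlet_commutator_kernel_continuous. }
  destruct (bounded_continuity (V := C_R_NormedModule) F 0 d (fun x _ => HC x)) as [K HK].
  assert (HK0 : 0 < K).
  { apply Rle_lt_trans with (2 := HK 0 ltac:(lra)); rewrite Cmod_C_R_norm; apply Cmod_ge_0. }
  apply le_epsilon; intros eps He.
  (* K, and so a, depends on N and t; this is harmless, as a is absent from the final bound. *)
  set (a := Rmin d (eps / K)).
  assert (0 < a) by (apply Rmin_glb_lt; [lra | apply Rdiv_lt_0_compat; lra]).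
  assert (a <= d) by apply Rmin_l.
  assert (a * K <= eps).
  { apply Rle_trans with (eps / K * K); [|right; field; lra].
    apply Rmult_le_compat_r; [lra | apply Rmin_r]. }
  assert (Ead : ex_RInt phi a d).
  { apply (ex_RInt_Chasles_1 (V := R_CompleteNormedModule) phi a d PI); [lra | apply Ex; lra]. }
  rewrite <- (CInt_Chasles F 0 a d) by (apply ex_CInt_continuous; exact HC).
  apply Rle_trans with (1 := Cmod_triangle _ _).
  assert (B1 : Cmod (CInt F 0 a) <= (a - 0) * K).
  { apply Cmod_CInt_le_const; [lra | | now apply ex_CInt_continuous].
    intros x Hx; rewrite <- Cmod_C_R_norm; apply Rlt_le, HK; lra. }
  assert (B2 : Cmod (CInt F a d) <= RInt (fun s => 2 * PI * M * phi s) a d).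
  { apply Cmod_CInt_le; [lra | | now apply ex_CInt_continuous | ].
    - intros s Hs; unfold F; rewrite Cmod_mult, Cmod_R.
      replace (2 * PI * M * phi s) with (PI / s * (2 * M * modulus m s))
        by (unfold phi; field; lra).
      apply Rmult_le_compat; auto using Rabs_pos, Cmod_ge_0.
      + apply dirichlet_bound; lra.
      + apply Cmod_commutator_kernel_le; auto; lra.
    - now apply (ex_RInt_scal (V := R_NormedModule)). }
  rewrite (RInt_scal (V := R_CompleteNormedModule)) in B2 by exact Ead.
  change scal with Rmult in B2.
  pose proof (RInt_Chasles (V := R_CompleteNormedModule) phi a d PI Ead (Ex d Hd)) as Ch.
  unfold plus in Ch; simpl in Ch.
  pose proof (Le a ltac:(lra)).
  assert (2 * PI * M * RInt phi a d <= 2 * PI * M * (J - RInt phi d PI)).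
  { apply Rmult_le_compat_l; [apply Rmult_le_pos; lra | lra]. }
  change mult with Rmult in B2. lra.
Qed.

(** The case d = pi of [dini_head]: the subtracted integral is over a point, and 1/(2 pi) cancels
    the factor 2 pi. *)
Lemma Cmod_commutator_le (m f : R -> C) (M : R) (N : nat) (t : R) :
  inC m -> inC f -> 0 <= M -> (forall x, Cmod (f x) <= M) ->
  ex_RInt_gen (fun s => modulus m s / s) (at_right 0) (at_point PI) ->
  Cmod (S_ N (pmul m f) t - m t * S_ N f t)
  <= M * RInt_gen (fun s => modulus m s / s) (at_right 0) (at_point PI).
Proof.
  intros Hm Hf HM Bf Hex.
  pose proof PI_RGT_0.
  rewrite S_pmul_commutator, Cmod_mult, Cmod_R by assumption.
  assert (0 < / (2 * PI)) by (apply Rinv_0_lt_compat; lra).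
  rewrite Rabs_pos_eq by lra.
  pose proof (dini_head m f M N t PI Hm Hf HM Bf Hex ltac:(lra)) as B.
  rewrite (RInt_point (V := R_CompleteNormedModule)) in B; change zero with 0 in B.
  apply Rmult_le_compat_l with (r := / (2 * PI)) in B; [|lra].
  apply Rle_trans with (1 := B); right; field; lra.
Qed.

Lemma commutator_cvg (m f : R -> C) (M eps : R) :
  inC m -> inC f -> 0 <= M -> (forall x, Cmod (f x) <= M) ->
  ex_RInt_gen (fun s => modulus m s / s) (at_right 0) (at_point PI) ->
  0 < eps ->
  exists N0 : nat, forall N t, (N0 <= N)%nat ->
    Cmod (S_ N (pmul m f) t - m t * S_ N f t) <= eps.
Proof.
  intros Hm Hf HM Bf Hex He; pose proof PI_RGT_0; pose proof PI2_3_2.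
  set (phi := fun s => modulus m s / s) in *; set (J := RInt_gen phi (at_right 0) (at_point PI)).
  destruct (RInt_gen_at_right phi PI PI_RGT_0 (fun s => dini_quotient_nonneg m s Hm) Hex) as (_ & _ & Small).
  (* The head, M times this Dini remainder, is then at most eps/2. *)
  destruct (Small (eps / (2 * (M + 1)))) as (d & Hd & Sd); [apply Rdiv_lt_0_compat; lra|].
  fold J in Sd.
  assert (Sin : forall s, d / 2 <= s <= 3 * (PI / 2) -> 0 < sin (s / 2)).
  { intros s Hs; apply sin_gt_0; lra. }
  (* An interval with [d, pi] in its interior that avoids the zeros 0 and 2 pi of sin (s/2). *)
  assert (G : equi (d / 2) (3 * (PI / 2))
                (fun t s => RtoC (/ sin (s / 2)) * commutator_kernel m f t s)%C).
  { apply equi_mult; [|now apply equi_commutator_kernel].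
    apply (equi_single (d / 2) (3 * (PI / 2)) (fun s => RtoC (/ sin (s / 2)))); [lra|].
    intros s Hs; apply continuous_RtoC, continuous_Rinv_comp.
    - apply (continuous_comp (fun s => s / 2) sin); [|apply continuous_sin].
      apply (continuous_mult (K := R_AbsRing)); [apply continuous_id | apply continuous_const].
    - specialize (Sin s Hs); lra. }
  (* Used with lam = N + 1/2, because D_N(s) = sin ((N + 1/2) s) / sin (s/2); the factor 2 pi
     offsets the 1/(2 pi) before the integral. *)
  destruct (riemann_lebesgue (d / 2) d PI (3 * (PI / 2)) _ ltac:(lra) ltac:(lra) G (2 * PI * (eps / 2)))
    as [L HL]; [nra|].
  destruct (INR_unbounded L) as [N0 HN0].
  exists N0; intros N t HN.
  assert (HNL : L <= INR N + / 2) by (apply le_INR in HN; lra).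
  specialize (HL _ t HNL).
  set (F := fun s => (RtoC (dirichlet N s) * commutator_kernel m f t s)%C).
  assert (HC : forall a b, ex_CInt F a b).
  { intros a b; apply ex_CInt_continuous; intros s; now apply dirichlet_commutator_kernel_continuous. }
  assert (Tail : Cmod (CInt F d PI) <= 2 * PI * (eps / 2)).
  { eapply Rle_trans with (2 := HL); right; f_equal.
    apply (RInt_ext (V := C_R_CompleteNormedModule)); intros s Hs.
    rewrite Rmin_left, Rmax_right in Hs by lra.
    specialize (Sin s ltac:(lra)).
    unfold F; rewrite <- sin_half_dirichlet, RtoC_mult, RtoC_inv by lra.
    assert (RtoC (sin (s / 2)) <> 0%C) by (intros E; apply RtoC_inj in E; lra).
    match goal with |- @eq _ ?a ?b => change (@eq C a b) end; field; assumption. }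
  pose proof (dini_head m f M N t d Hm Hf HM Bf Hex Hd) as Head; fold F phi J in Head.
  rewrite S_pmul_commutator, Cmod_mult, Cmod_R by assumption.
  assert (Hi : 0 < / (2 * PI)) by (apply Rinv_0_lt_compat; lra).
  rewrite Rabs_pos_eq by lra; fold F.
  rewrite <- (CInt_Chasles F 0 d PI) by auto.
  apply Rle_trans with (/ (2 * PI) * (2 * PI * M * (J - RInt phi d PI) + 2 * PI * (eps / 2))).
  { apply Rmult_le_compat_l; [lra|].
    apply Rle_trans with (1 := Cmod_triangle _ _); lra. }
  replace (/ (2 * PI) * (2 * PI * M * (J - RInt phi d PI) + 2 * PI * (eps / 2)))
    with (M * (J - RInt phi d PI) + eps / 2) by (field; lra).
  assert (M * (J - RInt phi d PI) <= M * (eps / (2 * (M + 1)))) by (apply Rmult_le_compat_l; lra).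
  assert (M * (eps / (2 * (M + 1))) <= eps / 2); [|lra].
  apply Rmult_le_reg_r with (2 * (M + 1)); [lra|].
  replace (M * (eps / (2 * (M + 1))) * (2 * (M + 1))) with (M * eps) by (field; lra). nra.
Qed.

(** * Extended-real norms and the multiplier estimate *)

Lemma normC_le (f : R -> C) (r : R) :
  (forall t, Cmod (f t) <= r) -> Rbar_le (normC f) r.
Proof.
  intros B; destruct (Lub_Rbar_correct (fun r : R => exists t : R, r = Cmod (f t))) as [_ H].
  apply H; intros x [t ->]; apply B.
Qed.

Lemma Cmod_le_normC (f : R -> C) (t : R) : Rbar_le (Cmod (f t)) (normC f).
Proof.
  destruct (Lub_Rbar_correct (fun r : R => exists t : R, r = Cmod (f t))) as [H _].
  apply H; now exists t.
Qed.

Lemma normC_le_normU (f : R -> C) (N : nat) : Rbar_le (normC (S_ N f)) (normU f).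
Proof.
  destruct (is_sup_seq_lub _ _ (Sup_seq_correct (fun N => normC (S_ N f)))) as [H _].
  apply H; now exists N.
Qed.

Lemma normU_le (f : R -> C) (b : Rbar) :
  (forall N, Rbar_le (normC (S_ N f)) b) -> Rbar_le (normU f) b.
Proof.
  intros B.
  destruct (is_sup_seq_lub _ _ (Sup_seq_correct (fun N => normC (S_ N f)))) as [_ H].
  apply H; intros x [N ->]; apply B.
Qed.

Lemma inU_unif (f : R -> C) : inU f ->
  forall eps, 0 < eps -> eventually (fun N => forall t, Cmod (f t - S_ N f t) <= eps).
Proof.
  intros [_ H] eps He; destruct (H (mkposreal eps He)) as [N0 HN].
  exists N0; intros N HN0 t; specialize (HN N HN0).
  pose proof (Cmod_le_normC (fun t => f t - S_ N f t)%C t) as B.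
  exact (Rbar_lt_le _ _ (Rbar_le_lt_trans _ _ _ B HN)).
Qed.

Lemma inU_of_unif (f : R -> C) : inC f ->
  (forall eps, 0 < eps -> eventually (fun N => forall t, Cmod (f t - S_ N f t) <= eps)) ->
  inU f.
Proof.
  intros Hf H; split; [exact Hf|]; intros eps; pose proof (cond_pos eps).
  (* Pointwise bounds pass to the supremum only non-strictly; halving restores the strict
     inequality. *)
  destruct (H (eps / 2)) as [N0 HN]; [lra|].
  exists N0; intros N HN0; apply Rbar_le_lt_trans with (eps / 2).
  - apply normC_le, HN, HN0.
  - simpl; lra.
Qed.

Lemma Cmod_S_le_normU (f : R -> C) (r : R) (N : nat) (t : R) :
  Rbar_le (normU f) r -> Cmod (S_ N f t) <= r.
Proof.
  intros H; refine (Rbar_le_trans (Cmod (S_ N f t)) _ r (Cmod_le_normC (S_ N f) t) _).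
  exact (Rbar_le_trans _ _ _ (normC_le_normU f N) H).
Qed.

(** f is the limit of its partial sums, so a common bound for them is inherited by f. *)
Lemma Cmod_le_normU (f : R -> C) (r : R) (t : R) :
  inU f -> Rbar_le (normU f) r -> Cmod (f t) <= r.
Proof.
  intros Hf H; apply le_epsilon; intros eps He.
  destruct (inU_unif f Hf eps He) as [N HN].
  pose proof (HN N (le_n N) t); pose proof (Cmod_S_le_normU f r N t H).
  replace (f t) with (S_ N f t + (f t - S_ N f t))%C by ring.
  apply Rle_trans with (1 := Cmod_triangle _ _); lra.
Qed.

Theorem theorem2 :
  forall m : R -> C,
    inC m ->
    ex_RInt_gen (fun delta : R => modulus m delta / delta)
      (at_right 0) (at_point PI) ->
    inMU m /\
    Rbar_le (normMU m)
      (Rbar_plus (normC m)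
         (Finite (2 * RInt_gen (fun delta : R => modulus m delta / delta)
                        (at_right 0) (at_point PI)))).
Proof.
  intros m Hm Hex; split; [split; [exact Hm|]|].
  - intros f Hf; pose proof (proj1 Hf) as HfC.
    destruct (inC_bounded m Hm) as (K & HK & Bm).
    destruct (inC_bounded f HfC) as (M & HM & Bf).
    apply inU_of_unif; [now apply inC_pmul|]; intros eps He.
    destruct (commutator_cvg m f M (eps / 2) Hm HfC HM Bf Hex) as [N1 H1]; [lra|].
    destruct (inU_unif f Hf (eps / (2 * (K + 1)))) as [N2 H2]; [apply Rdiv_lt_0_compat; lra|].
    exists (max N1 N2); intros N HN t.
    specialize (H1 N t ltac:(lia)); specialize (H2 N ltac:(lia) t).
    (* The error for m f is m times the error for f minus the commutator; each part is at most
       eps/2. *)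
    replace (pmul m f t - S_ N (pmul m f) t)%C
      with (m t * (f t - S_ N f t) - (S_ N (pmul m f) t - m t * S_ N f t))%C
      by (unfold pmul; ring).
    apply Rle_trans with (1 := Cmod_sub_triangle _ _); rewrite Cmod_mult.
    pose proof (Rmult_le_compat _ _ _ _ (Cmod_ge_0 _) (Cmod_ge_0 _) (Bm t) H2).
    assert (K * (eps / (2 * (K + 1))) <= eps / 2); [|lra].
    apply Rmult_le_reg_r with (2 * (K + 1)); [lra|].
    replace (K * (eps / (2 * (K + 1))) * (2 * (K + 1))) with (K * eps) by (field; lra). nra.
  - set (J := RInt_gen _ (at_right 0) (at_point PI)).
    (* The estimate below yields |m|_C + J; nonnegativity of J passes to the stated 2 J. *)
    assert (HJ : 0 <= J).
    { destruct (RInt_gen_at_right _ PI PI_RGT_0 (fun s => dini_quotient_nonneg m s Hm) Hex) as (_ & Le & _).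
      specialize (Le PI ltac:(pose proof PI_RGT_0; lra)).
      now rewrite (RInt_point (V := R_CompleteNormedModule)) in Le. }
    apply (proj2 (proj2_sig (Rbar_ex_lub _))).
    intros x (f & Hf & Hn & ->); apply normU_le; intros N.
    pose proof (Cmod_le_normC m) as Bm.
    (* If the norm were +infinity the bound would be trivial; -infinity is excluded by the value of
       m at 0. *)
    destruct (normC m) as [k| |]; [| now destruct (normC (S_ N (pmul m f))) | destruct (Bm 0)].
    change (Rbar_le (normC (S_ N (pmul m f))) (k + 2 * J)); apply normC_le; intros t.
    pose proof (Cmod_commutator_le m f 1 N t Hm (proj1 Hf) Rle_0_1
                  (fun x => Cmod_le_normU f 1 x Hf Hn) Hex) as B; fold J in B.
    pose proof (Rmult_le_compat _ _ _ _ (Cmod_ge_0 _) (Cmod_ge_0 _) (Bm t)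
                  (Cmod_S_le_normU f 1 N t Hn)).
    replace (S_ N (pmul m f) t)
      with (m t * S_ N f t + (S_ N (pmul m f) t - m t * S_ N f t))%C by ring.
    apply Rle_trans with (1 := Cmod_triangle _ _); rewrite Cmod_mult; lra.
Qed.
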